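(* Let $V$ be a vertex operator algebra, $W$ an ordinary $V$-module of conformal weight $0$, $U=V\rtimes W'$ the semidirect product vertex operator algebra, and $T\in\mathrm{Hom}_{\mathrm{LP}}(W,V)$. Assume that $V_1$, $W(1)$ and $W(1)^*$ are spanned by quasi-primary vectors. Let $$r=T-\sigma(T)=\sum_{t=0}^\infty\sum_{i=1}^{p_t}\big(T(v_i^t)\otimes(v_i^t)^*-(v_i^t)^*\otimes T(v_i^t)\big)\in U\widehat\otimes U,$$ where $\{v_i^t\}_{i=1}^{p_t}$ is a basis of $W(t)$ with dual basis $\{(v_i^t)^*\}_{i=1}^{p_t}$ of $W(t)^*$, and let $$\mathcal R=\sum_{i=1}^{p_1}\big(T(v_i^1)\otimes(v_i^1)^*-(v_i^1)^*\otimes T(v_i^1)\big)$$ be its homogeneous part in $U(1)\otimes U(1)$. If $r$ is a skewsymmetric solution to the $0$-VOYBE in $V\rtimes W'$, then $\mathcal R\in(V_1\rtimes W(1)^* )^{\otimes2}$ is a skewsymmetric solution to the classical Yang-Baxter equation $$[\mathcal R_{12},\mathcal R_{13}]+[\mathcal R_{12},\mathcal R_{23}]+[\mathcal R_{13},\mathcal R_{23}]=0$$ in the Lie algebra $V_1\rtimes W(1)^*$.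
   Context: The base field is $\mathbb C$. A vertex operator algebra (VOA) is understood in the usual sense and is $\mathbb N$-graded, $V=\bigoplus_{n\ge0}V_n$, $\dim V_n<\infty$, $V_n$ the eigenspace of $L(0)$ of eigenvalue $n$; $Y_V(a,z)=\sum_ma_mz^{-m-1}$, $Y_V(\omega,z)=\sum_nL(n)z^{-n-2}$. An ordinary $V$-module of conformal weight $0$ is a $V$-module $(W,Y_W)$ with $W=\bigoplus_{n\ge0}W(n)$, $\dim W(n)<\infty$, $L(0)=n$ on $W(n)$. Contragredient module: $W'=\bigoplus_nW(n)^*$, $\langle Y_{W'}(a,z)f,u\rangle=\langle f,Y_W(e^{zL(1)}(-z^{-2})^{L(0)}a,z^{-1})u\rangle$. A vector is quasi-primary if it is annihilated by $L(1)$. $T\in\mathrm{Hom}_{\mathrm{LP}}(W,V)$ means $T:W\to V$ linear with $T(W(n))\subseteq V_n$ for all $n$. Semidirect product VOA: $U=V\oplus W'$, $U(n)=V_n\oplus W(n)^*$, $Y_U(a+f,z)(b+g)=Y_V(a,z)b+Y_{W'}(a,z)g+Y_{W'V}^{W'}(f,z)b$, where $Y_{W'V}^{W'}(f,z)b=e^{zL(-1)}Y_{W'}(b,-z)f$; vacuum $\mathbf 1$ and $\omega$ are those of $V$. Lie algebras: $V_1$ is regarded as a Lie algebra with $[a,b]=a_0b$; it acts on $W(1)^*$ by $\rho^*(a)u^*=a_0u^*=\mathrm{Res}_zY_{W'}(a,z)u^*$, and $V_1\rtimes W(1)^*$ is $V_1\oplus W(1)^*$ with $[a+u^*,b+v^*]=[a,b]+\rho^*(a)v^*-\rho^*(b)u^*$.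 For $R=\sum_ix_i\otimes y_i$ in $\mathfrak g\otimes\mathfrak g$, the classical Yang-Baxter equation reads $\sum_{i,j}\big([x_i,x_j]\otimes y_i\otimes y_j+x_i\otimes[y_i,x_j]\otimes y_j+x_i\otimes x_j\otimes[y_i,y_j]\big)=0$. $m$-VOYBE in $U$: for $\alpha,\beta\in U$, put $\alpha\cdot_m\beta=\beta_m\alpha$; $\alpha\cdot'_m\beta=\mathrm{Res}_zz^mY_U(e^{zL(1)}(-z^{-2})^{L(0)}\alpha,z^{-1})\beta$; $\alpha\cdot'^{\mathrm{op}}_m\beta=\mathrm{Res}_zz^mY_U(e^{-zL(1)}(-z^{-2})^{L(0)}\beta,-z^{-1})e^{zL(1)}\alpha$. $U\widehat\otimes U=\prod_{p,q}U(p)\otimes U(q)$, $U^{\widehat\otimes3}=\prod_{p,q,s}U(p)\otimes U(q)\otimes U(s)$; $\sigma$ is the flip; skewsymmetric means $\sigma(r)=-r$. For diagonal $r=\sum_tr^t$ with $r^t=\sum_ix_i^t\otimes y_i^t\in U(t)\otimes U(t)$ (finite sum for each $t$), put $r_{12}\cdot_mr_{13}=\sum_{t,s}\sum_{i,k}(x_i^t\cdot_mx_k^s)\otimes y_i^t\otimes y_k^s$, $r_{23}\cdot'_mr_{12}=\sum_{q,t}\sum_{l,i}x_i^t\otimes(x_l^q\cdot'_my_i^t)\otimes y_l^q$, $r_{13}\cdot'^{\mathrm{op}}_mr_{23}=\sum_{s,q}\sum_{k,l}x_k^s\otimes x_l^q\otimes(y_k^s\cdot'^{\mathrm{op}}_my_l^q)$,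 well-defined in $U^{\widehat\otimes3}$. A skewsymmetric diagonal $r$ is a solution to the $m$-VOYBE if $r_{12}\cdot_mr_{13}-r_{23}\cdot'_mr_{12}+r_{13}\cdot'^{\mathrm{op}}_mr_{23}=0$. *)

(* Defs.v *)
From HB Require Import structures.
From mathcomp Require Import all_boot all_order all_algebra.
From mathcomp Require Import all_classical all_reals.
From mathcomp Require Import complex zify ring.

Set Implicit Arguments.
Unset Strict Implicit.
Unset Printing Implicit Defensive.

Import Order.TTheory GRing.Theory Num.Theory VectorInternalTheory.
Local Open Scope classical_set_scope.
Local Open Scope ring_scope.

(** Sums written [\sum_(k \in setT) F k] are finitely supported sums
    (the sum over the support of [F]); they render the sums over all of N
    in which only finitely many terms are nonzero. *)

(** The family [V : nat -> vectType K] stands for the N-graded space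
    [⊕_n V n] with finite-dimensional components; its underlying space is
    [dsum V]. *)

Section DirectSum.
Variables (K : fieldType) (V : nat -> vectType K).

Record dsum := DSum {
  dcomp :> forall n, V n;
  dsum_fin : exists N, forall n, (N <= n)%N -> dcomp n = 0 }.

Lemma dsumP (f g : dsum) : (forall n, f n = g n) -> f = g.
Proof.
case: f g => f Hf [g Hg] /= fg.
have E : f = g by apply: functional_extensionality_dep.
by subst g; congr DSum; exact: Prop_irrelevance.
Qed.

HB.instance Definition _ := gen_eqMixin dsum.
HB.instance Definition _ := gen_choiceMixin dsum.

Fact dsum0_fin : exists N, forall n, (N <= n)%N -> (0 : V n) = 0.
Proof. by exists 0%N. Qed.
Definition dsum0 := DSum dsum0_fin.

Fact dsumN_fin (f : dsum) : exists N, forall n, (N <= n)%N -> - f n = 0.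
Proof. by have [N H] := dsum_fin f; exists N => n /H ->; rewrite oppr0. Qed.
Definition dsumN f := DSum (dsumN_fin f).

Fact dsumD_fin (f g : dsum) : exists N, forall n, (N <= n)%N -> f n + g n = 0.
Proof.
have [N Hf] := dsum_fin f; have [M Hg] := dsum_fin g.
by exists (maxn N M) => n; rewrite geq_max => /andP[/Hf-> /Hg->]; rewrite addr0.
Qed.
Definition dsumD f g := DSum (dsumD_fin f g).

Fact dsumZ_fin c (f : dsum) : exists N, forall n, (N <= n)%N -> c *: f n = 0.
Proof. by have [N H] := dsum_fin f; exists N => n /H ->; rewrite scaler0. Qed.
Definition dsumZ c f := DSum (dsumZ_fin c f).

Fact dsumDA : associative dsumD.
Proof. by move=> f g h; apply: dsumP => n /=; rewrite addrA. Qed.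
Fact dsumDC : commutative dsumD.
Proof. by move=> f g; apply: dsumP => n /=; rewrite addrC. Qed.
Fact dsum0D : left_id dsum0 dsumD.
Proof. by move=> f; apply: dsumP => n /=; rewrite add0r. Qed.
Fact dsumND : left_inverse dsum0 dsumN dsumD.
Proof. by move=> f; apply: dsumP => n /=; rewrite addNr. Qed.

HB.instance Definition _ :=
  GRing.isZmodule.Build dsum dsumDA dsumDC dsum0D dsumND.

Fact dsumZA a b f : dsumZ a (dsumZ b f) = dsumZ (a * b) f.
Proof. by apply: dsumP => n /=; rewrite scalerA. Qed.
Fact dsumZ1 : left_id 1 dsumZ.
Proof. by move=> f; apply: dsumP => n /=; rewrite scale1r. Qed.
Fact dsumZDr : right_distributive dsumZ +%R.
Proof. by move=> a f g; apply: dsumP => n /=; rewrite scalerDr. Qed.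
Fact dsumZDl f : {morph dsumZ^~ f : a b / a + b}.
Proof. by move=> a b; apply: dsumP => n /=; rewrite scalerDl. Qed.

HB.instance Definition _ :=
  GRing.Zmodule_isLmodule.Build K dsum dsumZA dsumZ1 dsumZDr dsumZDl.

Definition single (n : nat) (v : V n) (k : nat) : V k :=
  if n =P k is ReflectT e then eq_rect n (fun i => V i : Type) v k e else 0.

Fact single_fin n (v : V n) :
  exists N, forall k, (N <= k)%N -> single v k = 0.
Proof.
exists n.+1 => k nk; rewrite /single; case: eqP => // e.
by exfalso; move: nk; rewrite -e ltnn.
Qed.
Definition dinj n (v : V n) : dsum := DSum (single_fin v).

End DirectSum.

Arguments single {K} V {n} v k.
Arguments dinj {K V n} v.

Section DirectSumTheory.
Variables (K : fieldType) (V : nat -> vectType K).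

Lemma single_id n (v : V n) : single V v n = v.
Proof. by rewrite /single; case: eqP => // e; rewrite eq_axiomK. Qed.

Lemma single_ne n (v : V n) k : n != k -> single V v k = 0.
Proof. by rewrite /single; case: eqP. Qed.

Lemma dinj_linear n : linear (@dinj K V n).
Proof.
move=> c u v; apply: dsumP => k /=.
have [<-|nk] := eqVneq n k; first by rewrite !single_id.
by rewrite !single_ne // scaler0 addr0.
Qed.

HB.instance Definition _ n := GRing.isLinear.Build K (V n) (dsum V) _
  (@dinj K V n) (@dinj_linear n).

Definition dproj n (f : dsum V) : V n := f n.

Fact dproj_linear n : linear (dproj n).
Proof. by []. Qed.

HB.instance Definition _ n := GRing.isLinear.Build K (dsum V) (V n) _
  (dproj n) (@dproj_linear n).

Lemma dsum_decomp (f : dsum V) N : (forall n, (N <= n)%N -> f n = 0) ->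
  f = \sum_(n < N) dinj (f n).
Proof.
move=> f0; apply: dsumP => k; rewrite -[RHS]/(dproj k _) linear_sum /=.
rewrite /dproj /=; have [kN|Nk] := ltnP k N.
  rewrite (bigD1 (Ordinal kN)) //= single_id big1 ?addr0 // => i ik.
  by rewrite single_ne //; apply: contraNneq ik => ik; apply/eqP/val_inj.
rewrite f0 // big1 // => i _; rewrite single_ne //.
by rewrite neq_ltn (leq_trans (ltn_ord i) Nk).
Qed.

End DirectSumTheory.

Lemma fsbig_nat (Z : zmodType) (n : nat) (F : nat -> Z) :
  (forall k, (n <= k)%N -> F k = 0) ->
  \sum_(k \in setT) F k = \sum_(k < n) F k.
Proof.
move=> F0; rewrite -(fsbig_widen `I_n setT) //; first by rewrite fsbig_ord.
by move=> k [_ /= /negP]; rewrite -leqNgt => /F0 ->.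
Qed.

(** [tens A B] is [A ⊗ B], realized as matrices through the bases of [A] and
    [B] given by [v2r]; [tlift f] is the map on [A ⊗ B] induced by a bilinear
    [f] (see [tlift_ten] and [tlift_linear]). *)

Section Tensor.
Variable K : fieldType.

Definition tens (A B : vectType K) : vectType K := 'M[K]_(dim A, dim B).

Definition ten (A B : vectType K) (x : A) (y : B) : tens A B :=
  (v2r x)^T *m v2r y.

Definition tflip (A B : vectType K) (w : tens A B) : tens B A := w^T.

Definition tlift (A B : vectType K) (Z : lmodType K) (f : A -> B -> Z)
    (w : tens A B) : Z :=
  \sum_i \sum_j (w : 'M_(_, _)) i j
    *: f (r2v (delta_mx 0 i)) (r2v (delta_mx 0 j)).

End Tensor.

Notation "x ⊗ y" := (ten x y) (at level 40, left associativity).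

Section TensorTheory.
Variables (K : fieldType) (A B : vectType K).

Lemma tflip_ten (x : A) (y : B) : tflip (x ⊗ y) = y ⊗ x.
Proof. by rewrite /tflip /ten trmx_mul trmxK. Qed.

Lemma tlift_linear (Z : lmodType K) (f : A -> B -> Z) : linear (tlift f).
Proof.
move=> c u v; rewrite /tlift scaler_sumr -big_split /=.
apply: eq_bigr => i _; rewrite scaler_sumr -big_split /=.
by apply: eq_bigr => j _; rewrite !mxE scalerDl scalerA.
Qed.

Lemma tlift_ten (Z : lmodType K) (f : A -> B -> Z) (x : A) (y : B) :
  (forall b, linear (f^~ b)) -> (forall a, linear (f a)) ->
  tlift f (x ⊗ y) = f x y.
Proof.
move=> fl fr.
have decomp (E : vectType K) (e : E) :
    e = \sum_i v2r e 0 i *: r2v (delta_mx 0 i).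
  apply: v2r_inj; rewrite linear_sum {1}[v2r e]row_sum_delta.
  by apply: eq_bigr => i _; rewrite linearZ /= r2vK.
have lsum (E : vectType K) (g : E -> Z) (I : finType) (c : I -> K) (F : I -> E) :
    linear g -> g (\sum_i c i *: F i) = \sum_i c i *: g (F i).
  move=> gl; have g0 : g 0 = 0.
    by have := gl (-1) 0 0; rewrite scaler0 addr0 scaleN1r addNr.
  elim/big_rec2: _ => // i e z _ IH.
  by rewrite gl IH.
rewrite {2}[x]decomp {2}[y]decomp (lsum _ (f^~ _)) //.
apply: eq_bigr => i _; rewrite lsum // scaler_sumr.
by apply: eq_bigr => j _; rewrite !mxE big_ord1 !mxE scalerA.
Qed.

End TensorTheory.

(** [Y a m b] is the mode [a_m b], where [Y(a,z) = \sum_m a_m z^(-m-1)]. *)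

Section VOA.
Variable K : numFieldType.

Record vdata := VData {
  vgr :> nat -> vectType K;
  vY : dsum vgr -> int -> dsum vgr -> dsum vgr;
  vac : vgr 0%N;
  omega : vgr 2%N }.

Arguments vY : clear implicits.

(** L(n) acting through the modes [YE] of [V] on a space [E] *)
Definition Lop (V : vdata) (E : Type) (YE : dsum V -> int -> E -> E)
    (n : int) : E -> E :=
  YE (dinj (omega V)) (n + 1).

Definition binz (p : int) (j : nat) : K :=
  (\prod_(i < j) (p - i%:Z)%:~R) / j`!%:R.

(** The Jacobi identity is stated through its coefficients (the Borcherds
    identity). *)
Record is_module (V : vdata) (W : nat -> vectType K)
    (YW : dsum V -> int -> dsum W -> dsum W) : Prop := {
  mod_linl : forall m w, linear (fun a => YW a m w);
  mod_linr : forall a m, linear (YW a m);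
  mod_trunc : forall a w, exists N : nat,
    forall m : nat, (N <= m)%N -> YW a m%:Z w = 0;
  mod_vac : forall m w,
    YW (dinj (vac V)) m w = if m == -1 then w else 0;
  mod_jacobi : forall a b w (p q r : int),
    \sum_(j \in setT) binz p j *: YW (vY V a (r + j%:Z) b) (p + q - j%:Z) w =
    \sum_(j \in setT) ((-1) ^+ j * binz r j) *:
      (YW a (p + r - j%:Z) (YW b (q + j%:Z) w)
       - (-1) ^ r *: YW b (q + r - j%:Z) (YW a (p + j%:Z) w));
  mod_Lm1 : forall a m w,
    YW (Lop (vY V) (-1) a) m w = (- m%:~R) *: YW a (m - 1) w;
  mod_L0 : forall n (w : W n), Lop YW 0 (dinj w) = n%:R *: dinj w }.

Record is_voa (V : vdata) : Prop := {
  voa_adj : is_module (vY V);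
  voa_creation : forall a (m : int), (-1 <= m) ->
    vY V a m (dinj (vac V)) = if m == -1 then a else 0;
  voa_virasoro : exists c : K, forall (m n : int) (a : dsum V),
    Lop (vY V) m (Lop (vY V) n a) - Lop (vY V) n (Lop (vY V) m a) =
    (m - n)%:~R *: Lop (vY V) (m + n) a
    + (if m + n == 0 then ((m ^+ 3 - m)%:~R / 12%:R * c) *: a else 0) }.

Record voa := VOA {
  voa_data :> vdata;
  voaP : is_voa voa_data }.

Record vmodule (V : vdata) := VModule {
  wgr :> nat -> vectType K;
  wY : dsum V -> int -> dsum wgr -> dsum wgr;
  vmoduleP : is_module wY }.

(** The coefficient of [z^k] in [e^(zL)] *)
Definition expc (E : lmodType K) (L : E -> E) (k : nat) (x : E) : E :=
  k`!%:R^-1 *: iter k L x.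

(** [conj_mode YE m a u] is
    [Res_z z^m YE(e^(zL(1)) (-z^(-2))^(L(0)) a, z^(-1)) u]: the part of weight
    [n] of [a] contributes
    [\sum_(k, j) (-1)^n z^(m - 2n + k + j + 1) (L(1)^k/k! a)_j u]. *)
Definition conj_mode (V : vdata) (E : lmodType K)
    (YE : dsum V -> int -> E -> E) (m : int) (a : dsum V) (u : E) : E :=
  \sum_(n \in setT) \sum_(k \in setT) (-1) ^+ n *:
    YE (expc (Lop (vY V) 1) k (dinj (a n))) (n%:Z *+ 2 - k%:Z - m - 2) u.

End VOA.

Arguments vY {K} _ _ _ _.
Arguments wY {K V} _ _ _ _.

Definition dual (K : fieldType) (E : vectType K) : vectType K := 'Hom(E, K^o).

Definition pairing (K : fieldType) (W : nat -> vectType K)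
    (f : dsum (fun n => dual (W n))) (u : dsum W) : K^o :=
  \sum_(n \in setT) f n (u n).

Section ModuleTheory.
Variables (K : numFieldType) (V : vdata K) (W : nat -> vectType K).
Variable YW : dsum V -> int -> dsum W -> dsum W.
Hypothesis HW : is_module YW.

HB.instance Definition _ a m :=
  GRing.isLinear.Build K (dsum W) (dsum W) _ (YW a m) (mod_linr HW a m).

Lemma mode0v m w : YW 0 m w = 0.
Proof.
by have := mod_linl HW m w (-1) 0 0; rewrite scaler0 addr0 scaleN1r addNr.
Qed.

Lemma modev0 a m : YW a m 0 = 0.
Proof. exact: linear0. Qed.

Lemma L0_mode b q w : Lop YW 0 (YW b q w) =
  YW b q (Lop YW 0 w) + YW (Lop (vY V) (-1) b) (q + 1) w
  + YW (Lop (vY V) 0 b) q w.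
Proof.
have := mod_jacobi HW (dinj (omega V)) b w 1 q 0.
rewrite (@fsbig_nat _ 2); last first.
  move=> [|[|k]] // _; rewrite /binz big_ord_recl big_ord_recl /=.
  by rewrite subrr mul0r mulr0 mul0r scale0r.
rewrite (@fsbig_nat _ 1); last first.
  move=> [|k] // _; rewrite /binz big_ord_recl /=.
  by rewrite subrr !mul0r mulr0 scale0r.
rewrite big_ord_recl big_ord1 big_ord1 /binz /= !big_ord_recl !big_ord0 /=.
rewrite !subr0 !expr0 !expr0z !mulr1 /bump /= !mul1r invr1.
rewrite !scale1r [1 + q]addrC addrK /Lop => /eqP; rewrite eq_sym subr_eq.
by move/eqP ->; rewrite [LHS]addrC [LHS]addrA.
Qed.

Lemma L0_comp w n : Lop YW 0 w n = n%:R *: w n.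
Proof.
have [N w0] := dsum_fin w; rewrite {1}(dsum_decomp w0) /Lop linear_sum /=.
rewrite -[LHS]/(dproj n _) linear_sum.
under eq_bigr do rewrite -[YW _ _ _]/(Lop YW 0 _) (mod_L0 HW) linearZ /=.
rewrite /dproj /=; have [nN|Nn] := ltnP n N.
  rewrite (bigD1 (Ordinal nN)) //= single_id big1 ?addr0 // => i ni.
  by rewrite single_ne ?scaler0.
rewrite w0 // scaler0 big1 // => i _; rewrite single_ne ?scaler0 //.
by rewrite neq_ltn (leq_trans (ltn_ord i) Nn).
Qed.

Lemma wt_dinj n (w : W n) : Lop YW 0 (dinj w) = n%:Z%:~R *: dinj w.
Proof. exact: mod_L0. Qed.

Lemma wt_comp w (x : int) n :
  Lop YW 0 w = x%:~R *: w -> x != n%:Z -> w n = 0.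
Proof.
move=> wx xn; have := L0_comp w n; rewrite wx -[LHS]/(x%:~R *: w n) => /eqP.
rewrite -subr_eq0 -scalerBl scaler_eq0 -[n%:R]/(n%:Z%:~R) -intrB intr_eq0.
by rewrite subr_eq0 (negPf xn) => /eqP.
Qed.

Lemma wt_mode b w (x y q : int) :
  Lop (vY V) 0 b = x%:~R *: b -> Lop YW 0 w = y%:~R *: w ->
  Lop YW 0 (YW b q w) = (x + y - q - 1)%:~R *: YW b q w.
Proof.
move=> bx wy; rewrite L0_mode bx wy linearZ /= (mod_Lm1 HW) addrK.
have lZ : YW (x%:~R *: b) q w = x%:~R *: YW b q w.
  by have := mod_linl HW q w x%:~R b 0; rewrite !addr0 mode0v addr0.
rewrite lZ -!scalerDl; congr (_ *: _).
by ring.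
Qed.

End ModuleTheory.

Section Contragredient.
Variables (K : numFieldType) (V : voa K) (W : vmodule V).

Let HV : is_module (vY V) := voa_adj (voaP V).
Let HW : is_module (wY W) := vmoduleP W.

Lemma expc_wt k p (a : V p) :
  Lop (vY V) 0 (expc (Lop (vY V) 1) k (dinj a)) =
  (p%:Z - k%:Z)%:~R *: expc (Lop (vY V) 1) k (dinj a).
Proof.
suff H : Lop (vY V) 0 (iter k (Lop (vY V) 1) (dinj a)) =
    (p%:Z - k%:Z)%:~R *: iter k (Lop (vY V) 1) (dinj a).
  have L0Z c b : Lop (vY V) 0 (c *: b) = c *: Lop (vY V) 0 b.
    have := mod_linr HV (dinj (omega V)) (0 + 1) c b 0.
    by rewrite addr0 (modev0 HV) addr0.
  by rewrite /expc L0Z H !scalerA mulrC.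
elim: k => [|k IH]; first by rewrite subr0 (mod_L0 HV).
rewrite iterS [in RHS]/Lop [X in Lop _ 0 X]/Lop.
rewrite (wt_mode HV (x := 2) _ _ IH) ?(mod_L0 HV) //.
by congr (_%:~R *: _); lia.
Qed.

Lemma expc0 k p (a : V p) : (p < k)%N -> expc (Lop (vY V) 1) k (dinj a) = 0.
Proof.
move=> pk; apply: dsumP => n; apply: (wt_comp HV (expc_wt k a)).
by apply/eqP => E; lia.
Qed.

Lemma expc_0 k p : expc (Lop (vY V) 1) k (dinj (0 : V p)) = 0.
Proof.
rewrite linear0 /expc (_ : iter k _ 0 = 0) ?scaler0 //.
by elim: k => //= k ->; exact: (modev0 HV).
Qed.

Lemma conj_modeE m (a : dsum V) P (u : dsum W) :
  (forall n, (P <= n)%N -> a n = 0) ->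
  conj_mode (wY W) m a u =
  \sum_(n < P) \sum_(k < n.+1) (-1) ^+ n *:
    wY W (expc (Lop (vY V) 1) k (dinj (a n))) (n%:Z *+ 2 - k%:Z - m - 2) u.
Proof.
move=> a0; rewrite /conj_mode (@fsbig_nat _ P).
  apply: eq_bigr => n _; apply: fsbig_nat => k nk.
  by rewrite expc0 // (mode0v HW) scaler0.
move=> n /a0 ->; rewrite (@fsbig_nat _ 0) ?big_ord0 // => k _.
by rewrite expc_0 (mode0v HW) scaler0.
Qed.

Lemma conj_mode_comp0 m (a : dsum V) P n (u : W n) r :
  (forall n, (P <= n)%N -> a n = 0) -> (r + P + `|m| <= n)%N ->
  conj_mode (wY W) m a (dinj u) r = 0.
Proof.
move=> a0 rn; rewrite (conj_modeE _ _ a0) -[LHS]/(dproj r _) linear_sum.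
rewrite big1 // => p _; rewrite linear_sum big1 // => k _; rewrite linearZ /=.
rewrite /dproj (wt_comp HW (wt_mode HW _ (expc_wt _ _) (wt_dinj HW _))) ?scaler0 //.
by apply/eqP => E; have := ltn_ord p; lia.
Qed.

Definition contra_comp (a : dsum V) (m : int) (f : dsum (fun n => dual (W n)))
    (n : nat) : dual (W n) :=
  linfun (fun u : W n => pairing f (conj_mode (wY W) m a (dinj u))).

Lemma contra_fin a m f :
  exists N, forall n, (N <= n)%N -> contra_comp a m f n = 0.
Proof.
have [P a0] := dsum_fin a; have [D f0] := dsum_fin f.
exists (D + P + `|m|)%N => n Nn; rewrite -[RHS]/(linfun \0); congr linfun.
apply: functional_extensionality_dep => u /=; rewrite /pairing (@fsbig_nat _ D).
  rewrite big1 // => r _; rewrite (conj_mode_comp0 _ a0) ?linear0 //.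
  by have := ltn_ord r; lia.
by move=> r /f0 ->; rewrite zero_lfunE.
Qed.

(** [Y_{W'}]: the [z^(-m-1)] coefficient of the contragredient action is read
    off [conj_mode]; see [contraE]. *)
Definition contraY (a : dsum V) (m : int) (f : dsum (fun n => dual (W n))) :
  dsum (fun n => dual (W n)) := DSum (contra_fin a m f).

Lemma contraE a m f u :
  pairing (contraY a m f) u = pairing f (conj_mode (wY W) m a u).
Proof.
have [P a0] := dsum_fin a; have [D f0] := dsum_fin f.
have [N u0] := dsum_fin u.
have pairE v : pairing f v = \sum_(n < D) f n (dproj n v).
  by apply: fsbig_nat => n /f0 ->; rewrite zero_lfunE.
have cl : linear (conj_mode (wY W) m a).
  move=> c v w; rewrite !(conj_modeE _ _ a0) scaler_sumr -big_split.
  apply: eq_bigr => n _; rewrite scaler_sumr -big_split; apply: eq_bigr => k _.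
  by rewrite (mod_linr HW) scalerDr !scalerA mulrC.
pose C := GRing.isLinear.Build _ _ _ _ (conj_mode (wY W) m a) cl.
pose F : {linear dsum W -> dsum W} := HB.pack (conj_mode (wY W) m a) C.
have compE n (v : W n) :
    contra_comp a m f n v = pairing f (conj_mode (wY W) m a (dinj v)).
  have pl : linear (fun u : W n => pairing f (F (dinj u)) : K^o).
    move=> c v1 v2; rewrite !pairE scaler_sumr -big_split; apply: eq_bigr => i _.
    by rewrite !linearP.
  pose L := GRing.isLinear.Build _ _ _ _ _ pl.
  pose G : {linear W n -> K^o} := HB.pack (fun u => pairing f (F (dinj u))) L.
  by rewrite /contra_comp (lfunE G).
rewrite {1}/pairing (@fsbig_nat _ N); last by move=> n /u0 ->; rewrite linear0.
under eq_bigr do rewrite compE pairE.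
rewrite exchange_big /= pairE {2}(dsum_decomp u0); apply: eq_bigr => r _.
rewrite -[conj_mode _ _ _ (\sum_(n < N) _)]/(F (\sum_(n < N) _)).
by rewrite (linear_sum F) (linear_sum (dproj r)) (linear_sum (f r)).
Qed.

End Contragredient.

Arguments contraY {K V} W _ _ _.

Section Semidirect.
Variables (K : numFieldType) (V : voa K) (W : vmodule V).

Definition semi_gr (n : nat) : vectType K := (V n * dual (W n))%type.

Fact semi1_fin (x : dsum semi_gr) :
  exists N, forall n, (N <= n)%N -> (x n).1 = 0.
Proof. by have [N H] := dsum_fin x; exists N => n /H ->. Qed.
Definition semi1 x : dsum V := DSum (semi1_fin x).

Fact semi2_fin (x : dsum semi_gr) :
  exists N, forall n, (N <= n)%N -> (x n).2 = 0.
Proof. by have [N H] := dsum_fin x; exists N => n /H ->. Qed.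
Definition semi2 x : dsum (fun n => dual (W n)) := DSum (semi2_fin x).

Fact semi_pair_fin (a : dsum V) (f : dsum (fun n => dual (W n))) :
  exists N, forall n, (N <= n)%N -> (a n, f n) = 0 :> semi_gr n.
Proof.
have [N Ha] := dsum_fin a; have [M Hf] := dsum_fin f.
by exists (maxn N M) => n; rewrite geq_max => /andP[/Ha-> /Hf->].
Qed.
Definition semi_pair a f : dsum semi_gr := DSum (semi_pair_fin a f).

(** The modes of [Y_{W'V}^{W'}(f,z) b = e^(zL(-1)) Y_{W'}(b,-z) f]: the
    coefficient of [z^(-m-1)] collects the terms
    [z^k L(-1)^k/k! (-z)^(-j-1) b_j f] with [j = m + k]. *)
Definition swapY (f : dsum (fun n => dual (W n))) (m : int) (b : dsum V) :
  dsum (fun n => dual (W n)) :=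
  \sum_(k \in setT) (-1) ^ (m + k%:Z + 1) *:
    expc (Lop (contraY W) (-1)) k (contraY W b (m + k%:Z) f).

Definition semiY (x : dsum semi_gr) (m : int) (y : dsum semi_gr) :
  dsum semi_gr :=
  semi_pair (vY V (semi1 x) m (semi1 y))
            (contraY W (semi1 x) m (semi2 y) + swapY (semi2 x) m (semi1 y)).

Definition semidirect : vdata K :=
  @VData K semi_gr semiY (vac V, 0) (omega V, 0).

Definition bracket1 (a b : V 1%N) : V 1%N := vY V (dinj a) 0 (dinj b) 1%N.

Definition rho_dual (a : V 1%N) (u : dual (W 1%N)) : dual (W 1%N) :=
  contraY W (dinj a) 0 (dinj (V := fun n => dual (W n)) u) 1%N.

Definition semi_bracket (x y : semidirect 1%N) : semidirect 1%N :=
  (bracket1 x.1 y.1, rho_dual x.1 y.2 - rho_dual y.1 x.2).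

End Semidirect.

Section YangBaxter.
Variable K : numFieldType.

Definition tskew (A : vectType K) (r : tens A A) : Prop := tflip r = - r.

(** [br] is an arbitrary operation here.  For [br a b = a_0 b] on [V_1], note
    that skewsymmetry of [br] only holds modulo [L(-1) V_0] in general. *)
Definition CYBE (g : vectType K) (br : g -> g -> g) (r : tens g g) : Prop :=
  tlift (fun xi yi => tlift (fun xj yj =>
    br xi xj ⊗ yi ⊗ yj + xi ⊗ br yi xj ⊗ yj + xi ⊗ xj ⊗ br yi yj) r) r = 0.

(** [ctens2 U] and [ctens3 U] are the completed tensor powers of [U]. *)
Definition ctens2 (U : nat -> vectType K) :=
  forall p q, tens (U p) (U q).
Definition ctens3 (U : nat -> vectType K) :=
  forall p q s, tens (tens (U p) (U q)) (U s).

Definition cskew (U : nat -> vectType K) (r : ctens2 U) : Prop :=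
  forall p q, tflip (r q p) = - r p q.

Definition diagonal (U : nat -> vectType K) (r : ctens2 U) : Prop :=
  forall p q, p != q -> r p q = 0.

(** The element [\sum_t d_t] of the completed tensor square *)
Definition diag_sum (U : nat -> vectType K) (d : forall t, tens (U t) (U t)) :
  ctens2 U := fun p q => single (fun q => tens (U p) (U q)) (d p) q.

Section Products.
Variables (U : vdata K) (m : int).

Definition dotm (a b : dsum U) : dsum U := vY U b m a.

Definition dotm' (a b : dsum U) : dsum U := conj_mode (vY U) m a b.

(** [Res_z z^m Y(e^(-zL(1)) (-z^(-2))^(L(0)) b, -z^(-1)) e^(zL(1)) a]: the part
    of weight [n] of [b] contributes the terms
    [(-1)^n (-1)^k (-1)^(j+1) z^(m - 2n + k + j + 1 + l)
       (L(1)^k/k! b)_j (L(1)^l/l! a)]. *)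
Definition dotm'op (a b : dsum U) : dsum U :=
  \sum_(n \in setT) \sum_(k \in setT) \sum_(l \in setT)
    let j := n%:Z *+ 2 - k%:Z - l%:Z - m - 2 in
    ((-1) ^+ n * (-1) ^+ k * (-1) ^ (j + 1)) *:
      vY U (expc (Lop (vY U) 1) k (dinj (b n))) j (expc (Lop (vY U) 1) l a).

(** The three products below are for diagonal [r].  In the component
    [U(p) ⊗ U(q) ⊗ U(s)], the two tensor factors that are not multiplied
    determine which homogeneous parts of [r] contribute. *)
Definition r12_r13 (r : ctens2 U) : ctens3 U := fun p q s =>
  tlift (fun xi yi => tlift (fun xk yk =>
    dotm (dinj xi) (dinj xk) p ⊗ yi ⊗ yk) (r s s)) (r q q).

Definition r23_r12 (r : ctens2 U) : ctens3 U := fun p q s =>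
  tlift (fun xl yl => tlift (fun xi yi =>
    xi ⊗ dotm' (dinj xl) (dinj yi) q ⊗ yl) (r p p)) (r s s).

Definition r13_r23 (r : ctens2 U) : ctens3 U := fun p q s =>
  tlift (fun xk yk => tlift (fun xl yl =>
    xk ⊗ xl ⊗ dotm'op (dinj yk) (dinj yl) s) (r q q)) (r p p).

Definition VOYBE_solution (r : ctens2 U) : Prop :=
  [/\ cskew r, diagonal r &
      forall p q s, r12_r13 r p q s - r23_r12 r p q s + r13_r23 r p q s = 0].

End Products.
End YangBaxter.

Arguments dotm {K} U m a b.
Arguments dotm' {K} U m a b.
Arguments dotm'op {K} U m a b.
Arguments r12_r13 {K} U m r.
Arguments r23_r12 {K} U m r.
Arguments r13_r23 {K} U m r.
Arguments VOYBE_solution {K} U m r.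
Arguments semi_bracket {K V} W x y.
Arguments bracket1 {K} V a b.

(** The component of weight [n] of the graded space [E], on which [V] acts by
    [YE], is spanned by quasi-primary vectors. *)
Definition spanned_qp (K : numFieldType) (V : vdata K)
    (E : nat -> vectType K) (YE : dsum V -> int -> dsum E -> dsum E)
    (n : nat) : Prop :=
  exists2 s : seq (E n), (forall x, x \in s -> Lop YE 1 (dinj x) = 0) &
    <<s>>%VS = fullv.

Section OperatorForm.
Variables (K : numFieldType) (V : voa K) (W : vmodule V).

Definition homLP (T : dsum W -> dsum V) : Prop :=
  forall n (w : W n), exists a : V n, T (dinj w) = dinj a.

Definition dual_basis (E : vectType K) n (X : n.-tuple E) (i : 'I_n) : dual E :=
  linfun (coord X i : E -> K^o).

Variables (T : dsum W -> dsum V) (p : nat -> nat).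
Variable v : forall t, (p t).-tuple (W t).

Definition Tpart (t : nat) : tens (semidirect W t) (semidirect W t) :=
  \sum_(i < p t)
    let Tv : semidirect W t := (T (dinj (tnth (v t) i)) t, 0) in
    let vs : semidirect W t := (0, dual_basis (v t) i) in
    Tv ⊗ vs - vs ⊗ Tv.

End OperatorForm.

(* Main.v *)
(** In weight 1 the quasi-primary hypotheses kill every [L(1)] correction, so
    the three products of the 0-VOYBE become [b_0 a], [- a_0 b] and [b_0 a],
    and its component in [U(1)^⊗3] is the classical Yang-Baxter equation for
    the opposite of the product [a_0 b] on [U(1)].  Moreover [L(-1)] vanishes
    from [W'(0)] to [W'(1)], so [a_0 b] is the semidirect bracket.  Reversing
    the three tensor factors and using the skewsymmetry of [r] twice replaces
    the opposite product by the product itself, which avoids the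
    skewsymmetry of [a_0 b] on [V_1] (in general false, as [L(-1) V_0] need
    not vanish). *)

From HB Require Import structures.
Require Import Defs.
From mathcomp Require Import all_boot all_order all_algebra.
From mathcomp Require Import all_classical all_reals.
From mathcomp Require Import complex.
From mathcomp Require Import zify.

Import GRing.Theory VectorInternalTheory.
Local Open Scope ring_scope.

(** * Direct sums and maps out of tensor products *)

Section DirectSumComponents.
Variables (K : fieldType) (V : nat -> vectType K).

Lemma dsumDE (f g : dsum V) n : (f + g) n = f n + g n. Proof. by []. Qed.

Lemma dsumNE (f : dsum V) n : (- f) n = - f n. Proof. by []. Qed.

Lemma dsumZE c (f : dsum V) n : (c *: f) n = c *: f n. Proof. by []. Qed.

End DirectSumComponents.

Section TensorLift.
Variables (K : fieldType) (A B : vectType K).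

Lemma ten_linearl (y : B) : linear (fun x : A => x ⊗ y).
Proof. by move=> c u v; rewrite /ten !linearP mulmxDl -scalemxAl. Qed.

Lemma ten_linearr (x : A) : linear (ten x : B -> _).
Proof. by move=> c u v; rewrite /ten !linearP. Qed.

Lemma tenNl (x : A) (y : B) : (- x) ⊗ y = - (x ⊗ y).
Proof. by rewrite /ten linearN linearN mulNmx. Qed.

Lemma tenNr (x : A) (y : B) : x ⊗ (- y) = - (x ⊗ y).
Proof. by rewrite /ten linearN mulmxN. Qed.

Lemma eq_tlift (Z : lmodType K) (f g : A -> B -> Z) w :
  (forall x y, f x y = g x y) -> tlift f w = tlift g w.
Proof.
by move=> fg; apply: eq_bigr => i _; apply: eq_bigr => j _; rewrite fg.
Qed.

Lemma tliftD (Z : lmodType K) (f g : A -> B -> Z) w :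
  tlift (fun x y => f x y + g x y) w = tlift f w + tlift g w.
Proof.
rewrite /tlift -big_split; apply: eq_bigr => i _ /=; rewrite -big_split.
by apply: eq_bigr => j _; rewrite /= scalerDr.
Qed.

Lemma linear_tlift (Y Z : lmodType K) (P : {linear Y -> Z}) (f : A -> B -> Y) w :
  P (tlift f w) = tlift (fun x y => P (f x y)) w.
Proof.
rewrite /tlift linear_sum; apply: eq_bigr => i _; rewrite linear_sum.
by apply: eq_bigr => j _; rewrite linearZ.
Qed.

Lemma tliftN (Z : lmodType K) (f : A -> B -> Z) w :
  tlift (fun x y => - f x y) w = - tlift f w.
Proof.
rewrite /tlift -sumrN; apply: eq_bigr => i _; rewrite -sumrN.
by apply: eq_bigr => j _; rewrite scalerN.
Qed.

Lemma tliftZ (Z : lmodType K) (c : K) (f : A -> B -> Z) w :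
  tlift (fun x y => c *: f x y) w = c *: tlift f w.
Proof.
rewrite /tlift scaler_sumr; apply: eq_bigr => i _; rewrite scaler_sumr.
by apply: eq_bigr => j _; rewrite !scalerA mulrC.
Qed.

Lemma tlift_opp (Z : lmodType K) (f : A -> B -> Z) w :
  tlift f (- w) = - tlift f w.
Proof.
rewrite /tlift -sumrN; apply: eq_bigr => i _; rewrite -sumrN.
by apply: eq_bigr => j _; rewrite mxE scaleNr.
Qed.

Lemma tlift_flip (Z : lmodType K) (f : A -> B -> Z) w :
  tlift f w = tlift (fun y x => f x y) (tflip w).
Proof.
rewrite /tlift exchange_big; apply: eq_bigr => i _.
by apply: eq_bigr => j _; rewrite mxE.
Qed.

End TensorLift.

(** Fubini for contractions: both sides expand to the same fourfold sum over coordinates. It lets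
    the two copies of [r] in a Yang-Baxter expression change places. *)
Lemma tlift_exchange (K : fieldType) (A B C D : vectType K) (Z : lmodType K)
    (f : A -> B -> C -> D -> Z) w w' :
  tlift (fun x y => tlift (f x y) w') w =
  tlift (fun x' y' => tlift (fun x y => f x y x' y') w) w'.
Proof.
rewrite {1}/tlift; under eq_bigr do under eq_bigr do rewrite -tliftZ.
rewrite {1}/tlift; under eq_bigr do rewrite exchange_big.
rewrite exchange_big; apply: eq_bigr => i _ /=.
under eq_bigr do rewrite exchange_big.
rewrite exchange_big; apply: eq_bigr => j _ /=.
rewrite scaler_sumr; apply: eq_bigr => k _; rewrite scaler_sumr.
by apply: eq_bigr => l _; rewrite !scalerA mulrC.
Qed.

(** * The classical Yang-Baxter equation under reversal of tensor factors *)

Section FlipOuter.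
Variables (K : numFieldType) (A : vectType K).

Definition tflip13 : tens (tens A A) A -> tens (tens A A) A :=
  tlift (fun ab c => tlift (fun a b => c ⊗ b ⊗ a) ab).

Fact tflip13_linear : linear tflip13.
Proof. exact: tlift_linear. Qed.

HB.instance Definition _ :=
  GRing.isLinear.Build K _ _ _ tflip13 tflip13_linear.

Lemma tflip13_ten a b c : tflip13 (a ⊗ b ⊗ c) = c ⊗ b ⊗ a.
Proof.
have l1 (c' : A) : linear (tlift (fun a b => c' ⊗ b ⊗ a)) by exact: tlift_linear.
rewrite /tflip13 tlift_ten //.
  rewrite tlift_ten //.
    by move=> b' d u v; rewrite ten_linearr.
  by move=> a' d u v; rewrite ten_linearr ten_linearl.
(* Linearity in the outer factor, which occurs under the inner sum, so that sum is opened. *)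
move=> ab d u v; rewrite /tlift scaler_sumr -big_split; apply: eq_bigr => i _.
rewrite scaler_sumr -big_split; apply: eq_bigr => j _ /=.
by rewrite !ten_linearl scalerDr !scalerA mulrC.
Qed.

(** Flipping one copy of a skewsymmetric tensor costs a sign; flipping both copies costs none. *)
Lemma tlift_skew2 (Z : lmodType K) (f : A -> A -> A -> A -> Z) (r : tens A A) :
  tskew r ->
  tlift (fun x y => tlift (f x y) r) r =
  tlift (fun x y => tlift (fun x' y' => f y x y' x') r) r.
Proof.
move=> rs; rewrite tlift_flip rs tlift_opp -tliftN; apply: eq_tlift => x y.
by rewrite tlift_flip rs tlift_opp opprK.
Qed.

(** The premise is the equation for the opposite of [br]. Reversing the three factors and flipping
    both copies of [r] turns its first, second and third terms into the third, second and first
    terms for [br] itself. *)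
Lemma CYBE_opp (br : A -> A -> A) (r : tens A A) : tskew r ->
  tlift (fun xi yi => tlift (fun xk yk => br xk xi ⊗ yi ⊗ yk) r) r
  + tlift (fun xl yl => tlift (fun xi yi => xi ⊗ br xl yi ⊗ yl) r) r
  + tlift (fun xk yk => tlift (fun xl yl => xk ⊗ xl ⊗ br yl yk) r) r = 0 ->
  CYBE br r.
Proof.
(* Coding a decomposable tensor as a triple gives one rewriting rule for all three terms. *)
have flipE (f : A -> A -> A -> A -> A * A * A) :
    tflip13 (tlift (fun x y => tlift (fun x' y' =>
      (f x y x' y').1.1 ⊗ (f x y x' y').1.2 ⊗ (f x y x' y').2) r) r) =
    tlift (fun x y => tlift (fun x' y' =>
      (f x y x' y').2 ⊗ (f x y x' y').1.2 ⊗ (f x y x' y').1.1) r) r.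
  rewrite linear_tlift; apply: eq_tlift => x y; rewrite linear_tlift.
  by apply: eq_tlift => x' y'; exact: tflip13_ten.
move=> rs /(congr1 tflip13); rewrite linear0 !linearD /=.
rewrite (flipE (fun xi yi xk yk => (br xk xi, yi, yk))) /=.
rewrite (flipE (fun xl yl xi yi => (xi, br xl yi, yl))) /=.
rewrite (flipE (fun xk yk xl yl => (xk, xl, br yl yk))) /=.
rewrite (tlift_skew2 _ (fun xi yi xk yk => yk ⊗ yi ⊗ br xk xi) _ rs).
rewrite (tlift_skew2 _ (fun xl yl xi yi => yl ⊗ br xl yi ⊗ xi) _ rs).
rewrite (tlift_skew2 _ (fun xk yk xl yl => br yl yk ⊗ xl ⊗ xk) _ rs).
(* In the two outer terms the copies of [r] are now nested in the order opposite to that of [CYBE];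
   the middle term already matches. *)
rewrite (tlift_exchange _ _ _ _ _ _ (fun xi yi xk yk => xk ⊗ xi ⊗ br yk yi)).
rewrite [X in _ + X]tlift_exchange addrC addrA addrAC => H.
rewrite /CYBE -[RHS]H -2!tliftD; apply: eq_tlift => x y.
by rewrite -2!tliftD.
Qed.

End FlipOuter.

(** * Quasi-primary vectors of weight 1 and the 0-VOYBE *)

Section Quasiprimary.
Variable K : numFieldType.

(** The kernel of a linear map is a subspace, so it contains the span of any vectors it contains. *)
Lemma spanned_qp_L1 (V : vdata K) (E : nat -> vectType K)
    (YE : dsum V -> int -> dsum E -> dsum E) n :
  linear (Lop YE 1) -> spanned_qp YE n ->
  forall x : E n, Lop YE 1 (dinj x) = 0.
Proof.
move=> L [s s0 sT] x; pose C := GRing.isLinear.Build _ _ _ _ _ L.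
pose F : {linear dsum E -> dsum E} := HB.pack (Lop YE 1) C.
rewrite -[LHS]/(F (dinj x)).
have: x \in <<in_tuple s>>%VS by rewrite sT memvf.
move/coord_span ->; rewrite !linear_sum big1 // => i _.
by rewrite !linearZ /= /F /= s0 ?scaler0 // mem_nth.
Qed.

(** This truncates [e^(zL)] to its constant term. Since [L] is a bare function, [L 0 = 0] stands in
    for linearity. *)
Lemma expcS_eq0 (E : lmodType K) (L : E -> E) k x :
  L 0 = 0 -> L x = 0 -> expc L k.+1 x = 0.
Proof.
move=> L0 Lx; rewrite /expc iterSr Lx (_ : iter k L 0 = 0) ?scaler0 //.
by elim: k => //= k ->.
Qed.

Lemma expc_zero (E : lmodType K) (L : E -> E) k : L 0 = 0 -> expc L k 0 = 0.
Proof.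
move=> L0; rewrite /expc (_ : iter k L 0 = 0) ?scaler0 //.
by elim: k => //= k ->.
Qed.

Lemma expc0E (E : lmodType K) (L : E -> E) x : expc L 0 x = x.
Proof. by rewrite /expc /= invr1 scale1r. Qed.

Lemma expc1E (E : lmodType K) (L : E -> E) x : expc L 1 x = L x.
Proof. by rewrite /expc /= invr1 scale1r. Qed.

Lemma fsbig_nat1 (Z : zmodType) (i : nat) (F : nat -> Z) :
  (forall k, k != i -> F k = 0) -> \sum_(k \in setT) F k = F i.
Proof.
move=> F0; rewrite (@fsbig_nat _ i.+1).
  by rewrite big_ord_recr /= big1 ?add0r // => j _; rewrite F0 // neq_ltn ltn_ord.
by move=> k ik; rewrite F0 // neq_ltn ik orbT.
Qed.

Section WeightOne.
Variables (V : vdata K) (E : nat -> vectType K).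
Variable YE : dsum V -> int -> dsum E -> dsum E.
Hypothesis YE0l : forall m u, YE 0 m u = 0.
Hypothesis L1V0 : Lop (vY V) 1 0 = 0.

(** For quasi-primary [a] of weight 1 the operator
    [e^(zL(1)) (-z^(-2))^(L(0))] is multiplication by [-z^(-2)]. *)
Lemma conj_mode_qp m (a : V 1%N) u : Lop (vY V) 1 (dinj a) = 0 ->
  conj_mode YE m (dinj a) u = - YE (dinj a) (- m) u.
Proof.
move=> La; rewrite /conj_mode (fsbig_nat1 _ 1%N) /= => [|n n1].
  rewrite (fsbig_nat1 _ 0%N) => [|[|k] // _].
    rewrite single_id expc0E expr1 scaleN1r; congr (- YE _ _ _); lia.
  by rewrite single_id expcS_eq0 // YE0l scaler0.
rewrite single_ne 1?eq_sym // linear0 (fsbig_nat1 _ 0%N) => [|k _];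
  by rewrite expc_zero // YE0l scaler0.
Qed.

End WeightOne.

(** Only [n = 1], [k = l = 0] survive. Then [j = 0], and the signs [(-1)^n] and [(-1)^(j + 1)]
    cancel, whereas [conj_mode_qp] keeps a single sign. *)
Lemma dotm'op_qp (U : vdata K) (a b : U 1%N) :
  (forall m x, vY U 0 m x = 0) -> (forall x m, vY U x m 0 = 0) ->
  (forall x : U 1%N, Lop (vY U) 1 (dinj x) = 0) ->
  dotm'op U 0 (dinj a) (dinj b) = vY U (dinj b) 0 (dinj a).
Proof.
move=> Y0 Yr0 L1; have L10 : Lop (vY U) 1 0 = 0 by exact: Yr0.
rewrite /dotm'op (fsbig_nat1 _ 1%N) /= => [|n n1].
  rewrite (fsbig_nat1 _ 0%N) /= => [|[|k] // _].
    rewrite (fsbig_nat1 _ 0%N) /= => [|[|l] // _].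
      rewrite single_id !expc0E (_ : _ *+ 2 - _ - _ - _ - _ = 0); last by lia.
      by rewrite expr0 mulr1 add0r expr1z expr1 mulrNN mulr1 scale1r.
    by rewrite [expc _ l.+1 _]expcS_eq0 // Yr0 scaler0.
  rewrite (fsbig_nat1 _ 0%N) /= => [|l _];
    by rewrite single_id [expc _ k.+1 _]expcS_eq0 // Y0 scaler0.
rewrite single_ne 1?eq_sym // linear0 (fsbig_nat1 _ 0%N) => [|k _];
  by rewrite (fsbig_nat1 _ 0%N) /= => [|l _]; rewrite expc_zero // Y0 scaler0.
Qed.

(** The component in [U(1)^⊗3] of the 0-VOYBE is exactly the premise of [CYBE_opp]. *)
Lemma VOYBE_CYBE (U : vdata K) (r : ctens2 U) :
  (forall m x, vY U 0 m x = 0) -> (forall x m, vY U x m 0 = 0) ->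
  (forall x : U 1%N, Lop (vY U) 1 (dinj x) = 0) ->
  VOYBE_solution U 0 r ->
  CYBE (fun a b => vY U (dinj a) 0 (dinj b) 1%N) (r 1%N 1%N).
Proof.
move=> Y0 Yr0 L1 [rs _ /(_ 1%N 1%N 1%N)] H; apply: CYBE_opp; first exact: rs.
rewrite -[RHS]H; congr (_ + _ + _).
  (* The sign from [conj_mode_qp] cancels the minus sign of the middle term; the mode index appears
     as [- 0]. *)
  rewrite -tliftN; apply: eq_tlift => x y; rewrite -tliftN.
  apply: eq_tlift => x' y'; rewrite /dotm' conj_mode_qp //; last exact: Yr0.
  by rewrite dsumNE tenNr tenNl opprK oppr0.
apply: eq_tlift => x y; apply: eq_tlift => x' y'; by rewrite dotm'op_qp.
Qed.

End Quasiprimary.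

(** * The contragredient module near weight 1 *)

Section ContragredientTheory.
Variables (K : numFieldType) (V : voa K) (W : vmodule V).
Let HV : is_module (vY V) := voa_adj (voaP V).
Let HW : is_module (wY W) := vmoduleP W.

Lemma pairing_dinjl n (f : dual (W n)) u :
  pairing (dinj (V := fun n => dual (W n)) f) u = f (u n).
Proof.
rewrite /pairing (fsbig_nat1 _ n) /= ?single_id // => k kn.
by rewrite single_ne 1?eq_sym // zero_lfunE.
Qed.

Lemma pairing_dinjr n (f : dsum (fun n => dual (W n))) (u : W n) :
  pairing f (dinj u) = f n u.
Proof.
rewrite /pairing (fsbig_nat1 _ n) /= ?single_id // => k kn.
by rewrite single_ne 1?eq_sym // linear0.
Qed.

Lemma pairingP c (f g : dsum (fun n => dual (W n))) u :
  pairing (c *: f + g) u = c *: pairing f u + pairing g u.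
Proof.
have [N u0] := dsum_fin u.
(* Bounding by the support of [u] gives all three pairings the same range. *)
have E h : pairing h u = \sum_(k < N) h k (u k).
  by apply: fsbig_nat => k /u0 ->; rewrite linear0.
rewrite !E scaler_sumr -big_split; apply: eq_bigr => k _.
by rewrite /= add_lfunE scale_lfunE.
Qed.

Lemma contraY_comp a m f n (w : W n) :
  contraY W a m f n w = pairing f (conj_mode (wY W) m a (dinj w)).
Proof. by rewrite -contraE pairing_dinjr. Qed.

Lemma contraY_linear a m : linear (contraY W a m).
Proof.
move=> c f g; apply: dsumP => n; apply/lfunP => w.
by rewrite contraY_comp pairingP -!contraY_comp /= add_lfunE scale_lfunE.
Qed.

Lemma contraY0r a m : contraY W a m 0 = 0.
Proof.
by have := contraY_linear a m (-1) 0 0; rewrite scaler0 addr0 scaleN1r addNr.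
Qed.

Lemma contraY0l m f : contraY W 0 m f = 0.
Proof.
apply: dsumP => n; apply/lfunP => w.
rewrite contraY_comp (@conj_modeE _ _ _ _ _ 0) // big_ord0.
by rewrite /pairing (@fsbig_nat _ 0) ?big_ord0 ?zero_lfunE // => k _; rewrite linear0.
Qed.

Lemma swapY0l m b : swapY (W:=W) 0 m b = 0.
Proof.
rewrite /swapY (@fsbig_nat _ 0) ?big_ord0 // => k _.
by rewrite contraY0r expc_zero ?scaler0 //; exact: contraY0r.
Qed.

Lemma swapY0r f m : swapY (W:=W) f m 0 = 0.
Proof.
rewrite /swapY (@fsbig_nat _ 0) ?big_ord0 // => k _.
by rewrite contraY0l expc_zero ?scaler0 //; exact: contraY0r.
Qed.

(** Since [omega = L(-2) 1], this follows from [[L(1), L(-2)] = 3 L(-1)], without central term as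
    [1 - 2] is nonzero, together with [L(1) 1 = L(-1) 1 = 0]. *)
Lemma L1_omega : Lop (vY V) 1 (dinj (omega V)) = 0.
Proof.
have [c Vir] := voa_virasoro (voaP V).
have cr := voa_creation (voaP V).
have L0 n : Lop (vY V) n 0 = 0 by exact: (modev0 HV).
have := Vir 1 (- 2%:Z) (dinj (vac V)).
have -> : Lop (vY V) (- 2%:Z) (dinj (vac V)) = dinj (omega V) by rewrite /Lop cr.
have -> : Lop (vY V) 1 (dinj (vac V)) = 0 by rewrite /Lop cr.
have -> : Lop (vY V) (1 - 2%:Z) (dinj (vac V)) = 0 by rewrite /Lop cr.
by rewrite L0 /= subr0 scaler0 addr0.
Qed.

Hypothesis L1V : forall a : V 1%N, Lop (vY V) 1 (dinj a) = 0.
Hypothesis L1W : forall w : W 1%N, Lop (wY W) 1 (dinj w) = 0.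

(** [L(-1)] on [W'] is the transpose of [L(1)] on [W]. *)
Lemma Lm1_contra1 f : Lop (contraY W) (-1) f 1%N = 0.
Proof.
apply/lfunP => w; rewrite /Lop contraY_comp.
have V0 m x : wY W 0 m x = 0 by exact: (mode0v HW).
have L10 : Lop (vY V) 1 0 = 0 by exact: (modev0 HV).
have -> : conj_mode (wY W) (-1 + 1) (dinj (omega V)) (dinj w) = 0.
  (* The only possible contribution has [n = 2], [k = 0]: its index [4 - 0 - 0 - 2 = 2] is the mode
     of [omega] that defines [L(1)]. *)
  rewrite /conj_mode (fsbig_nat1 _ 2%N) /= => [|n n2].
    rewrite (fsbig_nat1 _ 0%N) => [|[|k] // _].
      by rewrite single_id expc0E -[wY W _ _ _]/(Lop (wY W) 1 _) L1W scaler0.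
    by rewrite single_id expcS_eq0 ?L1_omega // V0 scaler0.
  rewrite single_ne 1?eq_sym // linear0 (fsbig_nat1 _ 0%N) => [|k _];
    by rewrite expc_zero // V0 scaler0.
by rewrite /pairing (@fsbig_nat _ 0) ?big_ord0 ?zero_lfunE // => k _; rewrite linear0.
Qed.

(** The result would have weight [1 - k < 0]. Dually, for [w] of weight [n] the mode [b_(-k) w] has
    weight [n + k >= 2], while [u] sees only weight 1. *)
Lemma contraY_wt1 (b : V 1%N) (u : dual (W 1%N)) k : (2 <= k)%N ->
  contraY W (dinj b) k%:Z (dinj (V := fun n => dual (W n)) u) = 0.
Proof.
move=> k2; apply: dsumP => n; apply/lfunP => w.
rewrite contraY_comp pairing_dinjl conj_mode_qp //; last first.
- exact: (modev0 HV).
- exact: (mode0v HW).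
rewrite dsumNE.
rewrite (wt_comp HW (wt_mode HW _ (wt_dinj HV b) (wt_dinj HW w))) ?oppr0 ?linear0 ?zero_lfunE //.
by apply/eqP => E; lia.
Qed.

(** In the expansion of [e^(zL(-1)) Y(b,-z) u], the terms with [k >= 2] vanish by weight, and the
    term [k = 1] lies in the image of [L(-1)], which [Lm1_contra1] kills in weight 1. The term
    [k = 0] carries the sign [(-1)^1]. *)
Lemma swapY_wt1 (b : V 1%N) (u : dual (W 1%N)) :
  swapY (W:=W) (dinj (V := fun n => dual (W n)) u) 0 (dinj b) 1%N = - rho_dual b u.
Proof.
rewrite /swapY (@fsbig_nat _ 2); last first.
  move=> k k2; rewrite add0r contraY_wt1 // expc_zero ?scaler0 //.
  exact: contraY0r.
rewrite big_ord_recl big_ord1 [expc _ ord0 _]expc0E.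
rewrite [expc _ (lift _ _) _]expc1E dsumDE 2!dsumZE.
by rewrite Lm1_contra1 scaler0 addr0 !add0r expr1z scaleN1r.
Qed.

End ContragredientTheory.

(** * The semidirect product in weight 1 *)

Section SemidirectTheory.
Variables (K : numFieldType) (V : voa K) (W : vmodule V).
Let HV : is_module (vY V) := voa_adj (voaP V).
Let U := semidirect W.

Lemma semi1_dinj n (x : U n) : semi1 (dinj x) = dinj x.1.
Proof.
apply: dsumP => k /=; have [<-|nk] := eqVneq n k; first by rewrite !single_id.
by rewrite !single_ne.
Qed.

Lemma semi2_dinj n (x : U n) :
  semi2 (dinj x) = dinj (V := fun n => dual (W n)) x.2.
Proof.
apply: dsumP => k /=; have [<-|nk] := eqVneq n k; first by rewrite !single_id.
by rewrite !single_ne.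
Qed.

Lemma semi10 : semi1 (0 : dsum U) = 0. Proof. exact: dsumP. Qed.

Lemma semi20 : semi2 (0 : dsum U) = 0. Proof. exact: dsumP. Qed.

Lemma semi_pair0 : semi_pair 0 0 = 0 :> dsum U.
Proof. exact: dsumP. Qed.

Lemma semiY0l m x : vY U 0 m x = 0.
Proof.
rewrite /= /semiY semi10 semi20 (mode0v HV) contraY0l swapY0l addr0.
exact: semi_pair0.
Qed.

Lemma semiY0r x m : vY U x m 0 = 0.
Proof.
rewrite /= /semiY semi10 semi20 (modev0 HV) contraY0r swapY0r addr0.
exact: semi_pair0.
Qed.

Hypothesis L1V : forall a : V 1%N, Lop (vY V) 1 (dinj a) = 0.
Hypothesis L1W : forall w : W 1%N, Lop (wY W) 1 (dinj w) = 0.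
Hypothesis L1W' : forall f : dual (W 1%N),
  Lop (contraY W) 1 (dinj (V := fun n => dual (W n)) f) = 0.

(** The conformal vector is [(omega, 0)], so [L(1)] acts separately on the two summands and the
    swapped action drops out. *)
Lemma semi_L1 (x : U 1%N) : Lop (vY U) 1 (dinj x) = 0.
Proof.
rewrite /Lop /= /semiY !semi1_dinj !semi2_dinj /= linear0 swapY0l addr0.
rewrite -[vY V _ _ _]/(Lop _ 1 _) -[contraY _ _ _ _]/(Lop (contraY W) 1 _).
by rewrite L1V L1W'; exact: semi_pair0.
Qed.

(** The actions of [V] on [V] and on [W'] give the first two terms of the bracket by definition; the
    swapped action supplies the term with the minus sign. *)
Lemma semiY_bracket (x y : U 1%N) :
  vY U (dinj x) 0 (dinj y) 1%N = semi_bracket W x y.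
Proof.
rewrite -[LHS]/(_, _) !semi1_dinj !semi2_dinj.
by rewrite -[X in (_, X)]/(_ + swapY _ _ _ _) swapY_wt1.
Qed.

End SemidirectTheory.

Theorem proposition4p4 (R : realType) (V : voa R[i]) (W : vmodule V)
    (T : {linear dsum W -> dsum V}) (hT : homLP T)
    (qpV : spanned_qp (vY V) 1%N) (qpW : spanned_qp (wY W) 1%N)
    (qpW' : spanned_qp (contraY W) 1%N)
    (p : nat -> nat) (v : forall t, (p t).-tuple (W t))
    (hv : forall t, basis_of fullv (v t)) :
  VOYBE_solution (semidirect W) 0 (diag_sum (Tpart T v)) ->
  tskew (Tpart T v 1%N) /\ CYBE (semi_bracket W) (Tpart T v 1%N).
Proof.
have L1V := spanned_qp_L1 _ _ _ _ _ (mod_linr (voa_adj (voaP V)) _ _) qpV.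
have L1W := spanned_qp_L1 _ _ _ _ _ (mod_linr (vmoduleP W) _ _) qpW.
have L1W' := spanned_qp_L1 _ _ _ _ _ (contraY_linear _ _ _ _ _) qpW'.
have rE : diag_sum (Tpart T v) 1%N 1%N = Tpart T v 1%N by rewrite /diag_sum single_id.
move=> sol; split.
  by case: sol => sk _ _; have := sk 1%N 1%N; rewrite rE.
(* Replacing the bracket by the product [a_0 b] brings the goal to the form of the general
   reduction. *)
have -> : semi_bracket W =
    fun a b => vY (semidirect W) (dinj a) 0 (dinj b) 1%N.
  by apply/funext => x; apply/funext => y; rewrite semiY_bracket.
rewrite -rE; apply: VOYBE_CYBE sol.
- exact: semiY0l.
- exact: semiY0r.
- exact: semi_L1.
Qed.
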